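(* Let $n\ge1$, $N=2^n$, and $\sigma_n\sim\mathrm{Unif}(B_{s,N})$. Then $L(\sigma_n)D(\sigma_n)=2^n$.
   Context: $L(\sigma)$ and $D(\sigma)$ denote the lengths of the longest increasing and longest decreasing subsequences of a permutation $\sigma$, i.e. the largest $k$ for which there are $i_1<\dots<i_k$ with $\sigma(i_1)<\dots<\sigma(i_k)$, respectively $\sigma(i_1)>\dots>\sigma(i_k)$. For permutations $\sigma\in S_a,\tau\in S_b$, $\sigma\otimes\tau\in S_{ab}$ is the permutation with $P_{\sigma\otimes\tau}=P_\sigma\otimes P_\tau$ (Kronecker product), where $P_\sigma\mathbf e_k=\mathbf e_{\sigma(k)}$. The group of simple binary butterfly permutations is $B_{s,N}=\bigotimes_{j=1}^nS_2=\{\sigma_1\otimes\cdots\otimes\sigma_n:\sigma_j\in S_2\}\subset S_N$. *)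

(* Defs.v *)
From HB Require Import structures.
From mathcomp Require Import all_boot all_order all_algebra all_fingroup.
From mathcomp Require Import mxtens.
From mathcomp Require Import all_classical all_reals all_analysis.

Set Implicit Arguments.
Unset Strict Implicit.
Unset Printing Implicit Defensive.

Import GRing.Theory.
Local Open Scope ring_scope.

(* Each i_1 < ... < i_k is a k-tuple of positions whose consecutive entries
   increase; the bound k <= N on the maximum loses nothing, since the entries
   of such a tuple are distinct. *)
Definition lis (N : nat) (s : 'S_N) : nat :=
  (\max_(k < N.+1 | [exists t : k.-tuple 'I_N,
       sorted [rel i j : 'I_N | i < j] t
       && sorted [rel i j : 'I_N | s i < s j] t]) k)%N.

Definition lds (N : nat) (s : 'S_N) : nat :=
  (\max_(k < N.+1 | [exists t : k.-tuple 'I_N,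
       sorted [rel i j : 'I_N | i < j] t
       && sorted [rel i j : 'I_N | s i > s j] t]) k)%N.

(* The convention P_s e_k = e_(s k) on column vectors is the transpose of the
   one of perm_mx, which acts on row vectors. *)
Definition pmat (N : nat) (s : 'S_N) : 'M[int]_N := (perm_mx s)^T.

Lemma pmat_delta (N : nat) (s : 'S_N) (k : 'I_N) :
  pmat s *m delta_mx k (0 : 'I_1) = delta_mx (s k) 0.
Proof.
by rewrite /pmat -colE; apply/matrixP => i j; rewrite !mxE ord1 eqxx andbT eq_sym.
Qed.

Lemma pmat_inj (N : nat) : injective (@pmat N).
Proof.
move=> s t /trmx_inj /matrixP e; apply/permP => i.
by have := e i (s i); rewrite !mxE eqxx; case: eqP.
Qed.

Lemma exists_ptens (a b : nat) (s : 'S_a) (t : 'S_b) :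
  exists r : 'S_(a * b), pmat r == tensmx (pmat s) (pmat t).
Proof.
pose f (k : 'I_(a * b)) :=
  mxtens_index (s (mxtens_unindex k).1, t (mxtens_unindex k).2).
have f_inj : injective f.
  move=> k l /(congr1 (@mxtens_unindex a b)); rewrite !mxtens_indexK.
  case=> /perm_inj e1 /perm_inj e2.
  rewrite -[k]mxtens_unindexK -[l]mxtens_unindexK; congr mxtens_index.
  by congr pair.
exists (perm f_inj); apply/eqP/matrixP => i j; rewrite !mxE permE /f.
rewrite -[X in _ == X]mxtens_unindexK (can_eq (@mxtens_indexK a b)).
by rewrite [mxtens_unindex i]surjective_pairing xpair_eqE -natrM mulnb.
Qed.

(* By pmat_inj, the permutation r with P_r = P_s (x) P_t is unique. *)
Definition ptens (a b : nat) (s : 'S_a) (t : 'S_b) : 'S_(a * b) :=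
  xchoose (exists_ptens s t).

Lemma pmat_ptens (a b : nat) (s : 'S_a) (t : 'S_b) :
  pmat (ptens s t) = tensmx (pmat s) (pmat t).
Proof. exact/eqP/(xchooseP (exists_ptens s t)). Qed.

(* s_0 (x) (s_1 (x) ... (x) (s_(n-1) (x) 1)), the empty product being the
   identity of S_1; the cast identifies 2 * 2 ^ n with 2 ^ n.+1. *)
Fixpoint ptens_iter (n : nat) : ('I_n -> 'S_2) -> 'S_(2 ^ n) :=
  match n return ('I_n -> 'S_2) -> 'S_(2 ^ n) with
  | 0 => fun=> 1%g
  | m.+1 => fun s => cast_perm (esym (expnS 2 m))
      (ptens (s ord0) (ptens_iter (fun i => s (lift ord0 i))))
  end.

Definition butterfly (n : nat) : {set 'S_(2 ^ n)} :=
  [set ptens_iter s | s : {ffun 'I_n -> 'S_2}].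

(* U carries the discrete sigma-algebra; being finite, its singletons suffice
   both for the measurability of X and for its law. *)
Definition uniform_on (d : measure_display) (T : measurableType d)
    (R : realType) (P : probability T R) (U : finType) (A : {set U})
    (X : T -> U) : Prop :=
  forall u : U,
    measurable (X @^-1` [set u])%classic /\
    P (X @^-1` [set u])%classic = ((u \in A)%:R / #|A|%:R)%:E.

(* Main.v *)
Require Import Defs.
From HB Require Import structures.
From mathcomp Require Import all_boot all_order all_algebra all_fingroup.
From mathcomp Require Import mxtens zify.
From mathcomp Require Import all_classical all_reals all_analysis.
Import GRing.Theory.

(** Both statistics are multiplicative for Kronecker products.  Writing
    a position of [ptens s t] as a pair (i, j) in the lexicographic order,
    [ptens s t] sends (i, j) to (s i, t j).  Hence a set C of positions is
    increasing exactly when its projection A on the first coordinate is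
    increasing for s and every fibre of C over A is increasing for t: this gives
    |C| <= L(s) L(t), and products of optimal sets attain the bound.  The same
    argument applies to decreasing sets ([longest_ptens]).

    A permutation of two points is either increasing or decreasing as a whole,
    so L(s) D(s) = 2 for every s in S_2 ([longest_S2]); by induction on n the
    product L D equals 2 ^ n at every element of the butterfly group
    ([lis_lds_ptens_iter]).  A uniform variable avoids each of the finitely many
    permutations outside the group almost surely, hence avoids all of them at
    once, which yields the almost sure identity.

    Increasing and decreasing subsequences are treated together, as sets of
    positions on which the permutation is monotone for a relation r on nat,
    instantiated with ltn or gtn. *)

(** * Monotone subsequences as sets of positions *)

Definition monotone_on (r : rel nat) {N : nat} (s : 'S_N) (A : {set 'I_N}) :=
  [forall i in A, forall j in A, (i < j)%N ==> r (s i) (s j)].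

Definition longest (r : rel nat) {N : nat} (s : 'S_N) : nat :=
  (\max_(A : {set 'I_N} | monotone_on r s A) #|A|)%N.

Lemma monotone_onP {r : rel nat} {N : nat} {s : 'S_N} {A : {set 'I_N}} :
  reflect {in A &, forall i j : 'I_N, (i < j)%N -> r (s i) (s j)}
    (monotone_on r s A).
Proof.
apply: (iffP forall_inP) => [h i j iA jA|h i iA].
  by apply/implyP; have /forall_inP := h i iA; apply.
by apply/forall_inP => j jA; apply/implyP; apply: h.
Qed.

Lemma monotone_on0 (r : rel nat) {N : nat} (s : 'S_N) : monotone_on r s finset.set0.
Proof. by apply/monotone_onP => i j; rewrite inE. Qed.

Lemma longest_attained (r : rel nat) {N : nat} (s : 'S_N) :
  exists2 A, monotone_on r s A & longest r s = #|A|.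
Proof.
rewrite /longest (bigmax_eq_arg finset.set0) ?monotone_on0 //.
by case: arg_maxnP => [|A hA _]; [exact: monotone_on0 | exists A].
Qed.

Lemma longest_ge {r : rel nat} {N : nat} {s : 'S_N} {A : {set 'I_N}} :
  monotone_on r s A -> (#|A| <= longest r s)%N.
Proof. exact: leq_bigmax_cond. Qed.

Lemma sorted_enum_ord {N : nat} (A : {set 'I_N}) :
  sorted [rel i j : 'I_N | i < j]%N (enum A).
Proof.
have lt_tr : transitive [rel i j : 'I_N | i < j]%N.
  by move=> ? ? ?; apply: ltn_trans.
rewrite {1}/enum_mem (sorted_filter lt_tr) // -enumT.
have := iota_ltn_sorted 0 N; rewrite -val_enum_ord sorted_map.
exact: sub_sorted.
Qed.

(** A tuple increasing in position is the enumeration of its set of entries, so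
    tuples and sets give the same maximum; transitivity of r is what lets the
    comparison of consecutive entries determine that of all pairs. *)
Lemma longestE (r : rel nat) (r_tr : transitive r) {N : nat} (s : 'S_N) :
  (\max_(k < N.+1 | [exists t : k.-tuple 'I_N,
       sorted [rel i j : 'I_N | i < j] t
       && sorted [rel i j : 'I_N | r (s i) (s j)] t]) k)%N = longest r s.
Proof.
have lt_tr : transitive [rel i j : 'I_N | i < j]%N.
  by move=> ? ? ?; apply: ltn_trans.
have rs_tr : transitive [rel i j : 'I_N | r (s i) (s j)].
  by move=> ? ? ?; apply: r_tr.
apply/eqP; rewrite eqn_leq; apply/andP; split.
  apply/bigmax_leqP => k /existsP[t /andP[t_lt t_r]].
  have t_uniq : uniq t by apply: (sorted_uniq lt_tr) t_lt => i; exact: ltnn.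
  have <- : #|[set i in t]| = k by rewrite cardsE (card_uniqP t_uniq) size_tuple.
  apply: longest_ge; apply/monotone_onP => i j; rewrite !inE => it jt lt_ij.
  move: t_r t_lt; rewrite (sorted_pairwise rs_tr) (sorted_pairwise lt_tr).
  move=> /(pairwiseP i) t_r /(pairwiseP i) t_lt.
  have ki : (index i t < size t)%N by rewrite index_mem.
  have kj : (index j t < size t)%N by rewrite index_mem.
  have := t_r (index i t) (index j t) ki kj.
  rewrite /= !nth_index //; apply.
  rewrite ltnNge leq_eqVlt; apply/negP => /orP[/eqP e|].
    have e' : j = i by rewrite -(nth_index i jt) e nth_index.
    by move: lt_ij; rewrite e' ltnn.
  move=> /(t_lt (index j t) (index i t) kj ki); rewrite /= !nth_index //.
  by rewrite ltnNge (ltnW lt_ij).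
apply/bigmax_leqP => A /monotone_onP A_r.
have cA : (#|A| < N.+1)%N by rewrite ltnS -[X in (_ <= X)%N]card_ord max_card.
apply: (bigmax_sup (Ordinal cA)) => //.
have sA : size (enum A) == #|A| by rewrite -cardE.
apply/existsP; exists (Tuple sA) => /=; rewrite sorted_enum_ord /=.
apply: (sub_in_sorted (P := [in A])) (sorted_enum_ord A).
  by move=> i j iA jA; apply: A_r.
by apply/allP => i; rewrite mem_enum.
Qed.

Lemma lisE {N : nat} (s : 'S_N) : lis s = longest ltn s.
Proof. exact: longestE ltn_trans N s. Qed.

Lemma ldsE {N : nat} (s : 'S_N) : lds s = longest gtn s.
Proof. by apply: (longestE gtn) => x y z /= xy yz; apply: ltn_trans xy. Qed.

(** * Multiplicativity for Kronecker products *)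

Lemma ptensE {a b : nat} (s : 'S_a) (t : 'S_b) (i : 'I_a) (j : 'I_b) :
  ptens s t (mxtens_index (i, j)) = mxtens_index (s i, t j).
Proof.
have := congr1 (fun M : 'M[int]_(a * b) =>
  M (mxtens_index (s i, t j)) (mxtens_index (i, j))) (pmat_ptens s t).
by rewrite tensmxE !mxE !eqxx mulr1; case: eqP.
Qed.

(** The index of the pair (i, j) in a Kronecker product is i * b + j.  Both ltn
    and gtn compare such indices digit by digit, and this is the property of r
    from which multiplicativity follows. *)
Definition lexicographic (r : rel nat) := forall b i i' j j' : nat,
  (j < b)%N -> (j' < b)%N ->
  r (i * b + j)%N (i' * b + j')%N = if i == i' then r j j' else r i i'.

Lemma lexicographic_ltn : lexicographic ltn.
Proof.
move=> b i i' j j' jb j'b /=; case: eqP => [->|ne]; first by rewrite ltn_add2l.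
by apply/idP/idP; nia.
Qed.

Lemma lexicographic_gtn : lexicographic gtn.
Proof.
move=> b i i' j j' jb j'b /=.
by have /= -> := lexicographic_ltn b i' i j' j j'b jb; rewrite eq_sym.
Qed.

(** For the upper bound, the first coordinates A of a monotone set C form
    a monotone set for s, because two positions with distinct first coordinates
    are compared by these alone, and the fibre B i of C over each i in A is
    monotone for t.  For the lower bound, a product of monotone sets is
    monotone. *)
Lemma longest_ptens (r : rel nat) (r_lex : lexicographic r) {a b : nat}
    (s : 'S_a) (t : 'S_b) :
  longest r (ptens s t) = (longest r s * longest r t)%N.
Proof.
have lt_lex (i i' : 'I_a) (j j' : 'I_b) :
    (mxtens_index (i, j) < mxtens_index (i', j'))%N
      = if i == i' then (j < j')%N else (i < i')%N.
  exact: (lexicographic_ltn b i i' j j').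
have r_st (i i' : 'I_a) (j j' : 'I_b) :
    r (ptens s t (mxtens_index (i, j))) (ptens s t (mxtens_index (i', j')))
      = if i == i' then r (t j) (t j') else r (s i) (s i').
  by rewrite !ptensE /= r_lex // (inj_eq val_inj) (inj_eq perm_inj).
apply/eqP; rewrite eqn_leq; apply/andP; split.
  apply/bigmax_leqP => C /monotone_onP C_r.
  pose A := [set (mxtens_unindex k).1 | k in C].
  pose B i := [set j : 'I_b | mxtens_index (i, j) \in C].
  have A_r : monotone_on r s A.
    apply/monotone_onP => _ _ /imsetP[k kC ->] /imsetP[k' k'C ->].
    rewrite -(mxtens_unindexK k) in kC; rewrite -(mxtens_unindexK k') in k'C.
    case: (mxtens_unindex k) kC => i j kC.
    case: (mxtens_unindex k') k'C => i' j' k'C /= lt_ii'.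
    have ne : (i == i') = false by apply/eqP => e; rewrite e ltnn in lt_ii'.
    by have := C_r _ _ kC k'C; rewrite lt_lex r_st ne; apply.
  have B_r i : monotone_on r t (B i).
    apply/monotone_onP => j j'; rewrite !inE => kC k'C lt_jj'.
    by have := C_r _ _ kC k'C; rewrite lt_lex r_st eqxx; apply.
  rewrite -[#|C|]sum1_card.
  rewrite (partition_big_imset (fun k => (@mxtens_unindex a b k).1)) -/A /=.
  apply: (@leq_trans (\sum_(i in A) longest r t)); last first.
    by rewrite sum_nat_const leq_mul2r longest_ge ?orbT.
  apply: leq_sum => i _; apply: leq_trans (longest_ge (B_r i)).
  rewrite sum1dep_card -(card_imset (mem (B i)) (f := fun j => mxtens_index (i, j))).
    apply/subset_leq_card/fintype.subsetP => k; rewrite inE => /andP[kC /eqP <-].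
    by apply/imsetP; exists (mxtens_unindex k).2;
      rewrite ?inE -?surjective_pairing mxtens_unindexK.
  by move=> j j' /(can_inj (@mxtens_indexK a b)) [].
have [A /monotone_onP A_r ->] := longest_attained r s.
have [B /monotone_onP B_r ->] := longest_attained r t.
rewrite -cardsX -(card_imset _ (can_inj (@mxtens_indexK a b))).
apply: longest_ge; apply/monotone_onP => k k'.
move=> /imsetP[[i j] /setXP[/= iA jB] ek] /imsetP[[i' j'] /setXP[/= i'A j'B] ek'].
rewrite {}ek {}ek'.
by rewrite lt_lex r_st; case: eqP => _; [apply: B_r | apply: A_r].
Qed.

(** * Simple butterfly permutations *)

Lemma longest_S1 (r : rel nat) (s : 'S_1) : longest r s = 1%N.
Proof.
apply/eqP; rewrite eqn_leq; apply/andP; split.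
  by apply/bigmax_leqP => A _; rewrite (leq_trans (max_card _)) ?card_ord.
rewrite -[X in (X <= _)%N](cards1 (ord0 : 'I_1)); apply: longest_ge.
by apply/monotone_onP => i j; rewrite !ord1.
Qed.

(** A singleton is monotone for every r, and the only larger set of positions
    is the whole of ['I_2]. *)
Lemma longest_S2 (r : rel nat) (s : 'S_2) :
  longest r s = (r (s ord0) (s ord_max)).+1.
Proof.
have lt2 (i j : 'I_2) : (i < j)%N -> i = ord0 /\ j = ord_max.
  by case: i j => [[|[|i]] hi] [[|[|j]] hj] //= _; split; apply: val_inj.
apply/eqP; rewrite eqn_leq; apply/andP; split.
  apply/bigmax_leqP => A /monotone_onP A_r.
  have := max_card (mem A); rewrite card_ord leq_eqVlt => /orP[A2|]; last first.
    by rewrite ltnS => A1; apply: leq_trans A1 _.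
  have /eqP AT : A == [set: 'I_2].
    by rewrite eqEcard finset.subsetT cardsT card_ord (eqP A2).
  by rewrite (eqP A2) A_r // AT inE.
case: (boolP (r _ _)) => [rs|_].
  rewrite -[X in (X <= _)%N](card_ord 2) -cardsT; apply: longest_ge.
  by apply/monotone_onP => i j _ _ /lt2[-> ->].
rewrite -[X in (X <= _)%N](cards1 (ord0 : 'I_2)); apply: longest_ge.
by apply/monotone_onP => i j /set1P -> /set1P ->; rewrite ltnn.
Qed.

Lemma longest_cast_perm (r : rel nat) {m n : nat} (e : m = n) (s : 'S_m) :
  longest r (cast_perm e s) = longest r s.
Proof. by case: n / e; rewrite cast_perm_id. Qed.

Lemma lis_lds_ptens_iter {n : nat} (s : 'I_n -> 'S_2) :
  (lis (ptens_iter s) * lds (ptens_iter s))%N = (2 ^ n)%N.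
Proof.
rewrite lisE ldsE; elim: n s => [|n IHn] s.
  exact: congr2 (longest_S1 ltn _) (longest_S1 gtn _).
rewrite [ptens_iter s]/= !longest_cast_perm.
rewrite (longest_ptens _ lexicographic_ltn) (longest_ptens _ lexicographic_gtn).
rewrite mulnACA IHn expnS !longest_S2; congr muln => /=.
have : s ord0 ord0 != s ord0 ord_max by rewrite (inj_eq perm_inj).
by rewrite neq_ltn; case: ltngtP.
Qed.

(** * Uniform random elements *)

(** Only finitely many values lie outside A, and each is taken with probability
    zero. *)
Lemma uniform_on_ae {d : measure_display} {T : measurableType d}
    {R : realType} {P : probability T R} {U : finType} {A : {set U}}
    {X : T -> U} :
  uniform_on P A X -> {ae P, forall w, X w \in A}.
Proof.
move=> X_unif.
have : {ae P, forall w, forall u, u \notin A -> X w <> u}.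
  apply: filter_forall => u.
  case: (boolP (u \in A)) => uA; first exact: aeW.
  have [mu Pu] := X_unif u.
  rewrite (negbTE uA) mul0r in Pu.
  have : P.-negligible (X @^-1` [set u])%classic by exact/negligibleP.
  apply: negligibleS => w /= Xw; apply: contrapT => Xu.
  by apply: Xw => _.
apply: filterS => w XA; apply: contrapT => /negP XwA.
exact: XA XwA erefl.
Qed.

Theorem proposition3 (n : nat) (hn : (1 <= n)%N)
    (d : measure_display) (T : measurableType d) (R : realType)
    (P : probability T R) (sigma : T -> 'S_(2 ^ n))
    (hsigma : uniform_on P (butterfly n) sigma) :
  {ae P, forall w, (lis (sigma w) * lds (sigma w))%N = (2 ^ n)%N}.
Proof.
apply: filterS (uniform_on_ae hsigma) => w /imsetP[s _ ->].
exact: lis_lds_ptens_iter.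
Qed.
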